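(* Let $k$ be a field, let $d\ge 1$ be an integer, and let $\mathcal{T}$ be a $k$-linear Hom-finite Krull-Schmidt triangulated category with a Serre functor $\nu$. Put $\nu_d:=\nu\circ[-d]$. Assume that $\mathcal{T}$ is $\nu_d$-finite, that $\mathcal{T}$ admits a silting object, and that $\mathcal{T}$ admits adjacent t-structures. Then there is a well-defined map $$\mathrm{silt}^d\,\mathcal{T}\to d\text{-}\mathrm{ctilt}\,\mathcal{T},\qquad P\mapsto \mathcal{U}_d(P):=\mathrm{add}\{\nu_d^i(P)\mid i\in\mathbb{Z}\};$$ that is, for every $d$-silting object $P$ of $\mathcal{T}$, the subcategory $\mathcal{U}_d(P)$ is a $d$-cluster tilting subcategory of $\mathcal{T}$.
   Context: A Serre functor is a $k$-linear autoequivalence $\nu$ of $\mathcal{T}$ with functorial isomorphisms $D\mathrm{Hom}_{\mathcal{T}}(X,Y)\simeq\mathrm{Hom}_{\mathcal{T}}(Y,\nu X)$, $D=\mathrm{Hom}_k(-,k)$. A full subcategory $\mathcal{P}\subset\mathcal{T}$ is silting if $\mathrm{Hom}_{\mathcal{T}}(\mathcal{P},\mathcal{P}[i])=0$ for all $i\ge1$ and the thick subcategory $\mathrm{thick}\,\mathcal{P}$ generated by $\mathcal{P}$ is $\mathcal{T}$; an object $P$ is silting if $\mathrm{add}\,P$ is. A silting subcategory (or object) $\mathcal{P}$ is called $d$-silting if $\mathrm{Hom}_{\mathcal{T}}(\nu(\mathcal{P}),\mathcal{P}[i])=0$ for all $i>d$. $\mathrm{silt}^d\,\mathcal{T}$ is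 the set of additive equivalence classes of $d$-silting subcategories of $\mathcal{T}$ (when $\mathcal{T}$ has a silting object every silting subcategory has an additive generator, so these are given by $d$-silting objects). A subcategory $\mathcal{U}\subset\mathcal{T}$ is $d$-cluster tilting if it is functorially finite and $\mathcal{U}=\{X\mid \mathrm{Hom}(\mathcal{U},X[i])=0,\ 1\le i\le d-1\}=\{X\mid \mathrm{Hom}(X,\mathcal{U}[i])=0,\ 1\le i\le d-1\}$. $d\text{-}\mathrm{ctilt}\,\mathcal{T}$ is the set of $d$-cluster tilting subcategories. $\mathcal{T}$ is $\nu_d$-finite if for all $X,Y\in\mathcal{T}$ there is $N$ such that $\mathrm{Hom}_{\mathcal{T}}(X,\nu_d^{-i}(Y)[j])=0$ for all $i\ge N$ and all $j\ge0$. For a silting subcategory $\mathcal{P}$ put $\mathcal{T}^{\mathcal{P}}_{\le0}:=\{X\in\mathcal{T}\mid\mathrm{Hom}_{\mathcal{T}}(\mathcal{P},X[i])=0\ \forall i>0\}$. $\mathcal{P}$ admits an adjacent t-structure if there is a t-structure $(\mathcal{X},\mathcal{Y})=(\mathcal{T}^{\le 0},\mathcal{T}^{\ge 0})$ on $\mathcal{T}$ with $\mathcal{X}=\mathcal{T}^{\mathcal{P}}_{\le0}$. $\mathcal{T}$ admits adjacent t-structures if every silting subcategory of $\mathcal{T}$ admits one. *)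

(* Defs.v *)
From HB Require Import structures.
From mathcomp Require Import all_boot all_order all_algebra.

Set Implicit Arguments.
Unset Strict Implicit.
Unset Printing Implicit Defensive.

Import Order.TTheory GRing.Theory Num.Theory.
Local Open Scope ring_scope.

(* Hom-finiteness is built in: a vectType k is a finite-dimensional k-vector
   space.  [mcomp g f] is "g after f". *)
Record linCat (k : fieldType) := LinCat {
  obj :> Type;
  mor : obj -> obj -> vectType k;
  idm : forall X, mor X X;
  mcomp : forall X Y Z, mor Y Z -> mor X Y -> mor X Z;
  mcompA : forall X Y Z W (h : mor Z W) (g : mor Y Z) (f : mor X Y),
    mcomp h (mcomp g f) = mcomp (mcomp h g) f;
  mcomp1m : forall X Y (f : mor X Y), mcomp (idm Y) f = f;
  mcompm1 : forall X Y (f : mor X Y), mcomp f (idm X) = f;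
  mcomp_linr : forall X Y Z (g : mor Y Z),
    linear (fun f : mor X Y => mcomp g f);
  mcomp_linl : forall X Y Z (f : mor X Y),
    linear (fun g : mor Y Z => mcomp g f)
}.

Arguments mor {k C} X Y : rename.
Arguments idm {k C} X : rename.
Arguments mcomp {k C X Y Z} g f : rename.

Notation "g \oc f" := (mcomp g f) (at level 40, left associativity) : ring_scope.

Section Linear.
Variables (k : fieldType) (C : linCat k).

Definition postcomp (X Y Z : C) (g : mor Y Z) (f : mor X Y) : mor X Z := g \oc f.
Definition precomp (X Y Z : C) (f : mor X Y) (g : mor Y Z) : mor X Z := g \oc f.

HB.instance Definition _ (X Y Z : C) (g : mor Y Z) :=
  GRing.isLinear.Build k (mor X Y) (mor X Z) *:%R (@postcomp X Y Z g)
    (@mcomp_linr k C X Y Z g).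
HB.instance Definition _ (X Y Z : C) (f : mor X Y) :=
  GRing.isLinear.Build k (mor Y Z) (mor X Z) *:%R (@precomp X Y Z f)
    (@mcomp_linl k C X Y Z f).

Definition hom0 (X Y : C) : Prop := forall f : mor X Y, f = 0.

Definition is_iso (X Y : C) (f : mor X Y) : Prop :=
  exists g : mor Y X, g \oc f = idm X /\ f \oc g = idm Y.

Definition is_zero_obj (Z : C) : Prop := idm Z = 0.

(* Z is a direct sum (biproduct) of the finite family X; for the empty family
   this says that Z is a zero object. *)
Definition is_dsum (I : finType) (X : I -> C) (Z : C) : Prop :=
  exists (inj : forall i, mor (X i) Z) (proj : forall i, mor Z (X i)),
    [/\ forall i, proj i \oc inj i = idm (X i),
        forall i j, i != j -> proj j \oc inj i = 0
      & \sum_(i : I) (inj i \oc proj i) = idm Z].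

Definition additive_cat : Prop :=
  forall n (X : 'I_n -> C), exists Z, is_dsum X Z.

Definition is_summand (X Y : C) : Prop :=
  exists X' : C, is_dsum (fun b : bool => if b then X else X') Y.

Definition local_end (X : C) : Prop :=
  idm X <> 0 /\
  forall f g : mor X X, ~ is_iso f -> ~ is_iso g -> ~ is_iso (f + g).

Definition krull_schmidt : Prop :=
  forall X : C, exists n (Y : 'I_n -> C), (forall i, local_end (Y i)) /\ is_dsum Y X.

(* Full subcategories are given by their classes of objects. *)
Definition fullsub := C -> Prop.

Definition addc (Q : fullsub) : fullsub := fun X =>
  exists n (Y : 'I_n -> C) (Z : C),
    [/\ forall i, Q (Y i), is_dsum Y Z & is_summand X Z].

Definition add_obj (P : C) : fullsub := addc (fun X => X = P).

Definition contravariantly_finite (U : fullsub) : Prop :=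
  forall X, exists (A : C) (f : mor A X),
    U A /\ forall (B : C) (g : mor B X), U B -> exists h : mor B A, g = f \oc h.

Definition covariantly_finite (U : fullsub) : Prop :=
  forall X, exists (A : C) (f : mor X A),
    U A /\ forall (B : C) (g : mor X B), U B -> exists h : mor A B, g = h \oc f.

Definition functorially_finite (U : fullsub) : Prop :=
  contravariantly_finite U /\ covariantly_finite U.

Record endofun := Endofun {
  fobj :> C -> C;
  fmap : forall X Y : C, mor X Y -> mor (fobj X) (fobj Y);
  fmap_lin : forall X Y : C, linear (@fmap X Y);
  fmap_id : forall X : C, fmap (idm X) = idm (fobj X);
  fmap_comp : forall (X Y Z : C) (g : mor Y Z) (f : mor X Y),
    fmap (g \oc f) = fmap g \oc fmap f
}.

Definition endofun_id : endofun :=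
  @Endofun id (fun X Y f => f) (fun _ _ _ _ _ => erefl) (fun _ => erefl)
    (fun _ _ _ _ _ => erefl).

Lemma endofun_comp_lin (F G : endofun) (X Y : C) :
  linear (fun f : mor X Y => fmap F (fmap G f)).
Proof. by move=> a f g; rewrite !fmap_lin. Qed.

Lemma endofun_comp_id (F G : endofun) (X : C) :
  fmap F (fmap G (idm X)) = idm (F (G X)).
Proof. by rewrite !fmap_id. Qed.

Lemma endofun_comp_comp (F G : endofun) (X Y Z : C) (g : mor Y Z) (f : mor X Y) :
  fmap F (fmap G (g \oc f)) = fmap F (fmap G g) \oc fmap F (fmap G f).
Proof. by rewrite !fmap_comp. Qed.

Definition endofun_comp (F G : endofun) : endofun :=
  @Endofun (fun X => F (G X)) (fun X Y f => fmap F (fmap G f))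
    (@endofun_comp_lin F G) (@endofun_comp_id F G) (@endofun_comp_comp F G).

Definition nat_iso (F G : endofun) : Prop :=
  exists a : forall X : C, mor (F X) (G X),
    (forall X, is_iso (a X)) /\
    (forall (X Y : C) (f : mor X Y), a Y \oc fmap F f = fmap G f \oc a X).

Record autoeq := Autoeq {
  afun :> endofun;
  ainv : endofun;
  aunit : nat_iso (endofun_comp ainv afun) endofun_id;
  acounit : nat_iso (endofun_comp afun ainv) endofun_id
}.

Lemma is_iso_comp (X Y Z : C) (g : mor Y Z) (f : mor X Y) :
  is_iso g -> is_iso f -> is_iso (g \oc f).
Proof.
move=> [g' [g1 g2]] [f' [f1 f2]]; exists (f' \oc g'); split.
  by rewrite mcompA -(mcompA f') g1 mcompm1.
by rewrite mcompA -(mcompA g) f2 mcompm1.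
Qed.

Lemma is_iso_fmap (F : endofun) (X Y : C) (f : mor X Y) :
  is_iso f -> is_iso (fmap F f).
Proof.
by move=> [g [e1 e2]]; exists (fmap F g); rewrite -!fmap_comp e1 e2 !fmap_id.
Qed.

Lemma nat_iso_id : nat_iso (endofun_comp endofun_id endofun_id) endofun_id.
Proof.
exists (fun X => idm X); split=> [X|X Y f] /=; last by rewrite mcomp1m mcompm1.
by exists (idm X); rewrite mcomp1m.
Qed.

Lemma nat_iso_cancel (F F' G G' : endofun) :
  nat_iso (endofun_comp G G') endofun_id ->
  nat_iso (endofun_comp F F') endofun_id ->
  nat_iso (endofun_comp (endofun_comp F G) (endofun_comp G' F')) endofun_id.
Proof.
move=> [a [aI aN]] [b [bI bN]].
exists (fun X => b X \oc fmap F (a (F' X))); split=> [X|X Y f] /=.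
  by apply: is_iso_comp; [exact: bI | apply: is_iso_fmap; exact: aI].
have /= aE := aN _ _ (fmap F' f); have /= bE := bN _ _ f.
by rewrite -mcompA -fmap_comp aE fmap_comp mcompA bE mcompA.
Qed.

Definition autoeq_id : autoeq := Autoeq nat_iso_id nat_iso_id.

Definition autoeq_comp (E1 E2 : autoeq) : autoeq :=
  @Autoeq (endofun_comp E1 E2) (endofun_comp (ainv E2) (ainv E1))
    (nat_iso_cancel (aunit E1) (aunit E2))
    (nat_iso_cancel (acounit E2) (acounit E1)).

Definition autoeq_inv (E : autoeq) : autoeq :=
  @Autoeq (ainv E) E (acounit E) (aunit E).

Definition autoeq_pow (E : autoeq) (n : int) : autoeq :=
  match n with
  | Posz m => iter m (autoeq_comp E) autoeq_id
  | Negz m => iter m.+1 (autoeq_comp (autoeq_inv E)) autoeq_id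
  end.

End Linear.

(* Verdier's axioms.  The suspension is an autoequivalence with a chosen
   quasi-inverse, not necessarily a strict automorphism.  [dist f g h] says
   that X -f-> Y -g-> Z -h-> X[1] is a distinguished triangle. *)
Record triCat (k : fieldType) := TriCat {
  tcat :> linCat k;
  tri_additive : additive_cat tcat;
  susp : autoeq tcat;
  dist : forall X Y Z : tcat, mor X Y -> mor Y Z -> mor Z (susp X) -> Prop;
  dist_iso : forall (X Y Z X' Y' Z' : tcat)
      (f : mor X Y) (g : mor Y Z) (h : mor Z (susp X))
      (f' : mor X' Y') (g' : mor Y' Z') (h' : mor Z' (susp X'))
      (a : mor X X') (b : mor Y Y') (c : mor Z Z'),
    is_iso a -> is_iso b -> is_iso c ->
    b \oc f = f' \oc a -> c \oc g = g' \oc b -> fmap susp a \oc h = h' \oc c ->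
    dist f g h -> dist f' g' h';
  dist_id : forall X Z : tcat, is_zero_obj Z ->
    dist (idm X) (0 : mor X Z) (0 : mor Z (susp X));
  dist_cone : forall (X Y : tcat) (f : mor X Y),
    exists (Z : tcat) (g : mor Y Z) (h : mor Z (susp X)), dist f g h;
  dist_rot : forall (X Y Z : tcat)
      (f : mor X Y) (g : mor Y Z) (h : mor Z (susp X)),
    dist f g h <-> dist g h (- fmap susp f);
  dist_mor : forall (X Y Z X' Y' Z' : tcat)
      (f : mor X Y) (g : mor Y Z) (h : mor Z (susp X))
      (f' : mor X' Y') (g' : mor Y' Z') (h' : mor Z' (susp X'))
      (a : mor X X') (b : mor Y Y'),
    dist f g h -> dist f' g' h' -> b \oc f = f' \oc a ->
    exists c : mor Z Z', c \oc g = g' \oc b /\ fmap susp a \oc h = h' \oc c;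
  dist_oct : forall (X Y Z X' Y' Z' : tcat)
      (f : mor X Y) (p : mor Y Z') (p' : mor Z' (susp X))
      (g : mor Y Z) (q : mor Z X') (q' : mor X' (susp Y))
      (r : mor Z Y') (r' : mor Y' (susp X)),
    dist f p p' -> dist g q q' -> dist (g \oc f) r r' ->
    exists (u : mor Z' Y') (v : mor Y' X'),
      [/\ dist u v (fmap susp p \oc q'),
          u \oc p = r \oc g, r' \oc u = p',
          v \oc r = q & q' \oc v = fmap susp f \oc r']
}.

(* nu is a k-linear autoequivalence, and for all X, Y
   serre_iso X Y : D Hom(X, Y) -> Hom(Y, nu X) is an isomorphism, natural in
   both variables; D Hom(X, Y) is 'Hom(mor X Y, k^o). *)
Record serreFunctor (k : fieldType) (C : linCat k) := SerreFunctor {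
  serre_fun :> autoeq C;
  serre_iso : forall X Y : C,
    'Hom('Hom(mor X Y, k^o), mor Y (serre_fun X));
  serre_bij : forall X Y : C, bijective (serre_iso X Y);
  serre_natl : forall (X X' Y : C) (f : mor X X') (phi : 'Hom(mor X Y, k^o)),
    serre_iso X' Y (phi \o linfun (precomp f))%VF
      = fmap serre_fun f \oc serre_iso X Y phi;
  serre_natr : forall (X Y Y' : C) (g : mor Y Y') (phi : 'Hom(mor X Y', k^o)),
    serre_iso X Y (phi \o linfun (postcomp g))%VF = serre_iso X Y' phi \oc g
}.

Section Silting.
Variables (k : fieldType) (T : triCat k).

(* [tshift X i] is X[i]; [nud d] below is nu o [-d]. *)
Definition tshift (X : T) (i : int) : T := autoeq_pow (susp T) i X.

Definition is_thick (U : fullsub T) : Prop :=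
  [/\ forall Z : T, is_zero_obj Z -> U Z,
      forall (X : T) (i : int), U X -> U (tshift X i),
      forall (X Y Z : T) (f : mor X Y) (g : mor Y Z) (h : mor Z (susp T X)),
        dist f g h -> U X -> U Y -> U Z
    & forall X Y : T, is_summand X Y -> U Y -> U X].

Definition thick (Q : fullsub T) : fullsub T := fun X =>
  forall U : fullsub T, is_thick U -> (forall Y, Q Y -> U Y) -> U X.

Definition silting (P : fullsub T) : Prop :=
  (forall (X Y : T) (i : int), P X -> P Y -> 1 <= i -> hom0 X (tshift Y i)) /\
  (forall X : T, thick P X).

Definition silting_obj (P : T) : Prop := silting (add_obj P).

Definition silt_le0 (P : fullsub T) : fullsub T := fun X =>
  forall (Q : T) (i : int), P Q -> 0 < i -> hom0 Q (tshift X i).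

(* L = T^{<=0} and G = T^{>=0}, both closed under isomorphism; an object Y
   lies in T^{>=1} = T^{>=0}[-1] iff Y[1] lies in T^{>=0}. *)
Definition tstructure (L G : fullsub T) : Prop :=
  [/\ (forall (X Y : T) (f : mor X Y), is_iso f -> L X -> L Y) /\
      (forall (X Y : T) (f : mor X Y), is_iso f -> G X -> G Y),
      forall X, L X -> L (tshift X 1),
      forall Y, G (tshift Y 1) -> G Y,
      forall X Y, L X -> G (tshift Y 1) -> hom0 X Y
    & forall Z, exists (X Y : T) (f : mor X Z) (g : mor Z Y)
        (h : mor Y (susp T X)), [/\ L X, G (tshift Y 1) & dist f g h]].

Definition admits_adjacent (P : fullsub T) : Prop :=
  exists L G : fullsub T, tstructure L G /\ (forall X, L X <-> silt_le0 P X).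

Definition admits_adjacent_tstructures : Prop :=
  forall P : fullsub T, silting P -> admits_adjacent P.

Definition cluster_tilting (d : nat) (U : fullsub T) : Prop :=
  [/\ functorially_finite U,
      forall X : T, U X <->
        (forall (Y : T) (i : int), U Y -> 1 <= i <= d%:Z - 1 -> hom0 Y (tshift X i))
    & forall X : T, U X <->
        (forall (Y : T) (i : int), U Y -> 1 <= i <= d%:Z - 1 -> hom0 X (tshift Y i))].

Variable nu : serreFunctor T.

Definition d_silting (d : nat) (P : fullsub T) : Prop :=
  silting P /\
  (forall (X Y : T) (i : int), P X -> P Y -> d%:Z < i -> hom0 (nu X) (tshift Y i)).

Definition d_silting_obj (d : nat) (P : T) : Prop := d_silting d (add_obj P).

Definition nud (d : nat) : autoeq T :=
  autoeq_comp nu (autoeq_pow (susp T) (- d%:Z)).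

Definition nud_finite (d : nat) : Prop :=
  forall X Y : T, exists N : int, forall i j : int, N <= i -> 0 <= j ->
    hom0 X (tshift (autoeq_pow (nud d) (- i) Y) j).

Definition Ud (d : nat) (P : T) : fullsub T :=
  addc (fun X => exists i : int, X = autoeq_pow (nud d) i P).

End Silting.

(* Main.v *)
Require Import Defs.
From HB Require Import structures.
From mathcomp Require Import all_boot all_order all_algebra.
From mathcomp Require Import zify.
From Stdlib Require Import Classical.

Set Implicit Arguments.
Unset Strict Implicit.
Unset Printing Implicit Defensive.

Import Order.TTheory GRing.Theory Num.Theory.
Local Open Scope ring_scope.

(** Let P be d-silting, and write X(j)[i] for the i-th shift of nu_d^j X.  The
aisle of the t-structure adjacent to P, which consists of the X with
Hom(P, X[i]) = 0 for i > 0, is called Le0 below.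

The whole argument manipulates the vanishing of Hom spaces.  Two rules suffice:
twists move between the two arguments ([hom0_twist]), and Serre duality reads
Hom(X, Y(a)[b]) = 0 iff Hom(Y, X(1-a)[d-b]) = 0 ([hom0_twist_serre]).  Both
hold because nu commutes with the shift as far as the vanishing of Hom is
concerned.

Since P generates T, an object receiving no map from any shift of P is zero
([generating]).  Truncating Y by the adjacent t-structure then shows that
Hom(A, Y) = 0 as soon as A lies in Le0 and Hom(P, Y[i]) = 0 for all i <= 0
([Le0_orth]).  Combined with Serre duality, the d-silting condition becomes
stability of Le0 under nu_d^-1 ([Le0_nud_inv]), whence Hom(P, P(j)[i]) = 0 for
0 < i < d: directly for j <= 0, and by duality for j > 0 ([orbit_rigid]).

Conversely, let X be indecomposable with Hom(P, X(j)[i]) = 0 for all j and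
0 < i < d.  Let A -> X(j) -> B -> A[1] be the truncation triangle of X(j).  The
hypothesis pushes B up to cohomological degrees >= d, and duality then kills
Hom(B, A[1]); the triangle splits, so X(j) is A or B ([local_dichotomy]).
By nu_d-finiteness X(j) lies in Le0 for j very negative and leaves it for j
large ([last_Le0]).  At the last j for which Y = X(j) lies in Le0, the object
Y(1) lives in degrees >= d, which dually says Hom(Y, P[i]) = 0 for i > 0.  The
cone Z of a right add P-approximation of Y satisfies Hom(Y, Z) = 0, so that Y is
a retract of the approximation ([Le0_perp_factors]), and X lies in U_d(P).
By the Krull-Schmidt property U_d(P) is therefore the class of all X with
Hom(P, X(j)[i]) = 0 for all j and 0 < i < d ([Ud_orbit_orth]).

This description is visibly invariant under nu_d and, through Serre duality,
left-right symmetric, so it gives both orthogonality conditions of cluster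
tilting at once; it also depends on add P only.  Functorial finiteness holds
because nu_d-finiteness leaves, for every X, only finitely many j with a nonzero
map between X and nu_d^j P ([functorially_finite_family]). *)

(** * Linear categories *)

Section LinearCat.
Variables (k : fieldType) (C : linCat k).
Implicit Types (X Y Z W : C) (E : autoeq C) (F : endofun C).

Lemma compm0 X Y Z (g : mor Y Z) : g \oc (0 : mor X Y) = 0.
Proof. exact: (raddf0 (postcomp g)). Qed.

Lemma comp0m X Y Z (f : mor X Y) : (0 : mor Y Z) \oc f = 0.
Proof. exact: (raddf0 (precomp f)). Qed.

Lemma compmD X Y Z (g : mor Y Z) (f f' : mor X Y) :
  g \oc (f + f') = g \oc f + g \oc f'.
Proof. exact: (raddfD (postcomp g)). Qed.

Lemma compmN X Y Z (g : mor Y Z) (f : mor X Y) : g \oc (- f) = - (g \oc f).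
Proof. exact: (raddfN (postcomp g)). Qed.

Lemma compNm X Y Z (g : mor Y Z) (f : mor X Y) : (- g) \oc f = - (g \oc f).
Proof. exact: (raddfN (precomp f)). Qed.

Lemma compmZ X Y Z (g : mor Y Z) a (f : mor X Y) : g \oc (a *: f) = a *: (g \oc f).
Proof. exact: (linearZZ (postcomp g)). Qed.

Lemma comp_sumr X Y Z I (r : seq I) (G : I -> mor X Y) (g : mor Y Z) :
  g \oc (\sum_(i <- r) G i) = \sum_(i <- r) (g \oc G i).
Proof. exact: (raddf_sum (postcomp g)). Qed.

Lemma comp_suml X Y Z I (r : seq I) (G : I -> mor Y Z) (f : mor X Y) :
  (\sum_(i <- r) G i) \oc f = \sum_(i <- r) (G i \oc f).
Proof. exact: (raddf_sum (precomp f)). Qed.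

HB.instance Definition _ F X Y :=
  GRing.isLinear.Build k (mor X Y) (mor (F X) (F Y)) *:%R (@fmap k C F X Y)
    (@fmap_lin k C F X Y).

Lemma idm_eq0_hom0 X : idm X = 0 -> forall W, hom0 W X.
Proof. by move=> X0 W f; rewrite -(mcomp1m f) X0 comp0m. Qed.

Definition retract X Y := exists (r : mor Y X) (s : mor X Y), r \oc s = idm X.

Lemma retract_hom0r W X Y : retract X Y -> hom0 W Y -> hom0 W X.
Proof.
by move=> [r [s rs]] h f; rewrite -(mcomp1m f) -rs -mcompA (h (s \oc f)) compm0.
Qed.

Lemma retract_hom0l W X Y : retract X Y -> hom0 Y W -> hom0 X W.
Proof.
by move=> [r [s rs]] h f; rewrite -(mcompm1 f) -rs mcompA (h (f \oc r)) comp0m.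
Qed.

Definition isom X Y := exists f : mor X Y, is_iso f.

Lemma isom_refl X : isom X X.
Proof. by exists (idm X), (idm X); rewrite mcomp1m. Qed.

Lemma isom_sym X Y : isom X Y -> isom Y X.
Proof. by move=> [f [g [gf fg]]]; exists g, f. Qed.

Lemma isom_trans Y X Z : isom X Y -> isom Y Z -> isom X Z.
Proof. by move=> [f fI] [g gI]; exists (g \oc f); apply: is_iso_comp. Qed.

Lemma isom_fmap F X Y : isom X Y -> isom (F X) (F Y).
Proof. by move=> [f fI]; exists (fmap F f); apply: is_iso_fmap. Qed.

Lemma isom_retract X Y : isom X Y -> retract X Y.
Proof. by move=> [f [g [gf _]]]; exists g, f. Qed.

Lemma isom_hom0r W X Y : isom X Y -> hom0 W X <-> hom0 W Y.
Proof.
by move=> XY; split; apply: retract_hom0r; apply: isom_retract => //; apply: isom_sym.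
Qed.

Lemma isom_hom0l W X Y : isom X Y -> hom0 X W <-> hom0 Y W.
Proof.
by move=> XY; split; apply: retract_hom0l; apply: isom_retract => //; apply: isom_sym.
Qed.

Lemma dsum_hom0r (I : finType) (Y : I -> C) Z W :
  is_dsum Y Z -> (forall i, hom0 W (Y i)) -> hom0 W Z.
Proof.
move=> [inj [proj [_ _ s1]]] h f.
rewrite -(mcomp1m f) -s1 comp_suml big1 // => i _.
by rewrite -mcompA (h i (proj i \oc f)) compm0.
Qed.

Lemma dsum_retract (I : finType) (Y : I -> C) Z i : is_dsum Y Z -> retract (Y i) Z.
Proof. by move=> [inj [proj [e _ _]]]; exists (proj i), (inj i). Qed.

(** * Autoequivalences *)

Lemma autoeq_unit_iso E X : isom (ainv E (E X)) X.
Proof. by have [a [aI _]] := aunit E; exists (a X); apply: aI. Qed.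

Lemma autoeq_counit_iso E X : isom (E (ainv E X)) X.
Proof. by have [a [aI _]] := acounit E; exists (a X); apply: aI. Qed.

Lemma autoeq_faithful E X Y : injective (@fmap k C E X Y).
Proof.
move=> f g fg; have [a [aI aN]] := aunit E.
have [b [ba ab]] := aI X.
have /= ef := aN _ _ f; have /= eg := aN _ _ g.
by rewrite -(mcompm1 f) -(mcompm1 g) -ab !mcompA -ef -eg fg.
Qed.

End LinearCat.

Section Autoequivalences.
Variables (k : fieldType) (C : linCat k).
Implicit Types (X Y Z W : C) (E : autoeq C) (F : endofun C).

(** Fullness of E reduces to faithfulness of its quasi-inverse, because the
    candidate preimage of g has the same image as g under the quasi-inverse. *)
Lemma autoeq_full E X Y (g : mor (E X) (E Y)) : exists f : mor X Y, fmap E f = g.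
Proof.
have [a [aI aN]] := aunit E.
have [b [ba ab]] := aI X; have [b' [b'a ab']] := aI Y.
exists (a Y \oc fmap (ainv E) g \oc b).
apply: (@autoeq_faithful _ _ (autoeq_inv E)).
have /= e := aN _ _ (a Y \oc fmap (ainv E) g \oc b).
rewrite -!mcompA ba mcompm1 mcompA in e.
by move/(congr1 (fun f => b' \oc f)): e; rewrite !mcompA b'a !mcomp1m => ->.
Qed.

Lemma hom0_fmap E X Y : hom0 (E X) (E Y) <-> hom0 X Y.
Proof.
split=> h f; last by have [g <-] := autoeq_full f; rewrite (h g) raddf0.
by apply: (@autoeq_faithful _ _ E); rewrite raddf0; apply: h.
Qed.

Lemma autoeq_iso_reflect E X Y (f : mor X Y) : is_iso (fmap E f) -> is_iso f.
Proof.
move=> [g']; have [g <-] := autoeq_full g'; move=> [e1 e2]; exists g.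
by split; apply: (@autoeq_faithful _ _ E); rewrite fmap_comp fmap_id.
Qed.

Lemma local_end_autoeq E X : local_end X -> local_end (E X).
Proof.
move=> [X0 XL]; split.
  by move=> e; apply: X0; apply: (@autoeq_faithful _ _ E); rewrite fmap_id raddf0.
move=> f' g'; have [f <-] := autoeq_full f'; have [g <-] := autoeq_full g'.
move=> fN gN; rewrite -raddfD => /autoeq_iso_reflect; apply: XL.
  by move=> fI; apply/fN/is_iso_fmap.
by move=> gI; apply/gN/is_iso_fmap.
Qed.

Lemma autoeq_powS E (i : int) X : isom (autoeq_pow E (i + 1) X) (E (autoeq_pow E i X)).
Proof.
case: i => [n|[|n]].
- by rewrite -PoszD addn1; apply: isom_refl.
- exact/isom_sym/autoeq_counit_iso.
- have -> : Negz n.+1 + 1 = Negz n by lia.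
  exact/isom_sym/autoeq_counit_iso.
Qed.

Lemma autoeq_powP E (i : int) X :
  isom (autoeq_pow E (i - 1) X) (ainv E (autoeq_pow E i X)).
Proof.
apply: isom_sym; apply: (isom_trans _ (autoeq_unit_iso E _)).
by apply: (isom_fmap (ainv E)); rewrite -{1}(subrK 1 i); apply: autoeq_powS.
Qed.

Lemma autoeq_powD E (i j : int) X :
  isom (autoeq_pow E (i + j) X) (autoeq_pow E i (autoeq_pow E j X)).
Proof.
elim: i => [|n IH|n IH]; first by rewrite add0r; apply: isom_refl.
  rewrite -addn1 PoszD addrAC; apply: isom_trans (autoeq_powS _ _ _) _.
  apply: (isom_trans (isom_fmap E IH)).
  exact/isom_sym/autoeq_powS.
have -> : - n.+1%:Z = - n%:Z - 1 by lia.
rewrite addrAC; apply: isom_trans (autoeq_powP _ _ _) _.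
apply: (isom_trans (isom_fmap (ainv E) IH)).
exact/isom_sym/autoeq_powP.
Qed.

Lemma autoeq_powNK E (i : int) X :
  isom (autoeq_pow E (- i) (autoeq_pow E i X)) X.
Proof.
by apply: isom_sym; rewrite -{1}[X]/(autoeq_pow E 0 X) -(addNr i); apply: autoeq_powD.
Qed.

Lemma hom0_pow_adj E (i : int) X Y :
  hom0 (autoeq_pow E i X) Y <-> hom0 X (autoeq_pow E (- i) Y).
Proof.
rewrite -(hom0_fmap (autoeq_pow E (- i)) (autoeq_pow E i X)).
by apply: isom_hom0l; apply: autoeq_powNK.
Qed.

(** * Morphisms factoring through a class of objects *)

(** Membership in add Q is handled through the ideal of morphisms that factor
    through finite sums of objects of Q: X lies in add Q iff this ideal contains
    the identity of X.  A morphism in the ideal is presented as a finite sum of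
    composites through single objects of Q, so that no direct sum has to be
    carried along and functors, sums and composites act termwise. *)
Record through (Q : fullsub C) X Y := Through {
  mid : C; midP : Q mid; leg1 : mor X mid; leg2 : mor mid Y }.

Definition factors (Q : fullsub C) X Y (f : mor X Y) : Prop :=
  exists s : seq (through Q X Y), f = \sum_(t <- s) (leg2 t \oc leg1 t).

Lemma factors0 Q X Y : factors Q (0 : mor X Y).
Proof. by exists [::]; rewrite big_nil. Qed.

Lemma factorsD Q X Y (f g : mor X Y) : factors Q f -> factors Q g -> factors Q (f + g).
Proof. by move=> [s ->] [t ->]; exists (s ++ t); rewrite big_cat. Qed.

Lemma factors_sum Q X Y (I : Type) (r : seq I) (f : I -> mor X Y) :
  (forall i, factors Q (f i)) -> factors Q (\sum_(i <- r) f i).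
Proof. by move=> h; elim/big_ind: _ => //; [apply: factors0 | apply: factorsD]. Qed.

Lemma factors_comp Q X Y Z W (f : mor Y Z) (a : mor X Y) (b : mor Z W) :
  factors Q f -> factors Q (b \oc f \oc a).
Proof.
move=> [s ->]; exists [seq Through (midP t) (leg1 t \oc a) (b \oc leg2 t) | t <- s].
by rewrite big_map comp_sumr comp_suml; apply: eq_bigr => t _ /=; rewrite !mcompA.
Qed.

Lemma factors_mid (Q : fullsub C) X Y B (b : mor B Y) (a : mor X B) :
  Q B -> factors Q (b \oc a).
Proof. by move=> QB; exists [:: Through QB a b]; rewrite big_seq1. Qed.

Lemma factors_fmap (Q Q' : fullsub C) F X Y (f : mor X Y) :
  (forall B, Q B -> Q' (F B)) -> factors Q f -> factors Q' (fmap F f).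
Proof.
move=> QQ' [s ->].
pose image (t : through Q X Y) :=
  Through (QQ' _ (midP t)) (fmap F (leg1 t)) (fmap F (leg2 t)).
exists (map image s).
by rewrite big_map raddf_sum; apply: eq_bigr => t _ /=; rewrite fmap_comp.
Qed.

Lemma factors_retract Q X Y : retract X Y -> factors Q (idm Y) -> factors Q (idm X).
Proof.
by move=> [r [s rs]] h; have := factors_comp s r h; rewrite mcompm1 rs.
Qed.

Lemma factors_dsum Q (I : finType) (Y : I -> C) Z :
  is_dsum Y Z -> (forall i, factors Q (idm (Y i))) -> factors Q (idm Z).
Proof.
move=> [inj [proj [_ _ <-]]] h; apply: factors_sum => i.
by have := factors_comp (proj i) (inj i) (h i); rewrite mcompm1.
Qed.

Lemma factors_hom0l Q X W : factors Q (idm X) -> (forall B, Q B -> hom0 B W) -> hom0 X W.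
Proof.
move=> [s e] h f; rewrite -(mcompm1 f) e comp_sumr big1 // => t _.
by rewrite mcompA (h _ (midP t) (f \oc leg2 t)) comp0m.
Qed.

Lemma factors_hom0r Q X W : factors Q (idm X) -> (forall B, Q B -> hom0 W B) -> hom0 W X.
Proof.
move=> [s e] h f; rewrite -(mcomp1m f) e comp_suml big1 // => t _.
by rewrite -mcompA (h _ (midP t) (leg1 t \oc f)) compm0.
Qed.

Lemma summand_retract X Y : is_summand X Y -> retract X Y.
Proof. by move=> [X' /(dsum_retract true)]. Qed.

Lemma addc_factors Q X : addc Q X -> factors Q (idm X).
Proof.
move=> [n [Y [Z [QY dZ /summand_retract XZ]]]]; apply: (factors_retract XZ).
apply: (factors_dsum dZ) => i; rewrite -[idm _]mcomp1m; exact: factors_mid.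
Qed.

(** * Approximations *)

Definition right_approx (Q : fullsub C) X A (f : mor A X) : Prop :=
  forall B (g : mor B X), Q B -> exists h : mor B A, g = f \oc h.

Lemma right_approx_addc Q X A (f : mor A X) :
  right_approx Q f -> right_approx (addc Q) f.
Proof.
move=> fQ B g /addc_factors [s e]; rewrite -(mcompm1 g) e comp_sumr.
elim/big_ind: _ => [|_ _ [h ->] [h' ->]|t _].
- by exists 0; rewrite compm0.
- by exists (h + h'); rewrite compmD.
- have [h hE] := fQ _ (g \oc leg2 t) (midP t).
  by exists (h \oc leg1 t); rewrite mcompA hE mcompA.
Qed.

(** Hom-finiteness: the direct sum of one copy of Q i for each member of a basis
    of Hom(Q i, X) carries all the basis maps, hence all maps, from the Q i. *)
Lemma right_approx_dsum (I : finType) (Q : I -> C) X : additive_cat C ->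
  exists n (Y : 'I_n -> C) A (f : mor A X),
    [/\ forall j, exists i, Y j = Q i, is_dsum Y A
      & right_approx (fun B => exists i, B = Q i) f].
Proof.
move=> addC.
pose J : finType := {i : I & 'I_(\dim (fullv : {vspace mor (Q i) X}))}.
pose src (t : J) := Q (tag t).
pose arr (t : J) : mor (src t) X := (vbasis fullv)`_(tagged t).
have [A dA] := addC #|J| (fun j => src (enum_val j)).
have [inj [proj [e1 e0 _]]] := dA.
pose f := \sum_j (arr (enum_val j) \oc proj j).
have f_inj j : f \oc inj j = arr (enum_val j).
  rewrite /f comp_suml (bigD1 j) //= -mcompA e1 mcompm1 big1 ?addr0 // => i ij.
  by rewrite -mcompA e0 ?compm0 // eq_sym.
have f_arr t : exists u : mor (src t) A, f \oc u = arr t.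
  by rewrite -(enum_rankK t); exists (inj (enum_rank t)); apply: f_inj.
exists #|J|, (fun j => src (enum_val j)), A, f; split=> //.
  by move=> j; exists (tag (enum_val j)).
move=> B g [i Bi]; subst B.
rewrite (coord_vbasis (memvf g)).
elim/big_ind: _ => [|_ _ [h ->] [h' ->]|l _].
- by exists 0; rewrite compm0.
- by exists (h + h'); rewrite compmD.
- have [u uE] := f_arr (Tagged (fun i => 'I_(\dim (fullv : {vspace mor (Q i) X}))) l).
  by exists (coord (vbasis fullv) l g *: u); rewrite compmZ uE.
Qed.

(** A direct sum is a summand of itself, with the empty direct sum as
    complement. *)
Lemma addc_dsum (Q : fullsub C) n (Y : 'I_n -> C) A :
  additive_cat C -> (forall j, Q (Y j)) -> is_dsum Y A -> addc Q A.
Proof.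
move=> addC QY dA; exists n, Y, A; split=> //.
have [Z [i0 [p0 [_ _ s0]]]] := addC 0%N (fun=> A).
have Z0 : idm Z = 0 by rewrite -s0 big_ord0.
exists Z.
exists (fun b => if b return mor (if b then A else Z) A then idm A else 0),
       (fun b => if b return mor A (if b then A else Z) then idm A else 0).
split=> [[]|[] []|]; rewrite ?mcomp1m ?compm0 ?comp0m ?Z0 //.
by rewrite big_bool /= compm0 mcomp1m addr0.
Qed.

(** The members of the family outside the image of J have no nonzero map to X,
    so they factor through any approximation. *)
Lemma right_approx_exists (I : Type) (Q : I -> C) (J : finType) (e : J -> I) X :
  additive_cat C ->
  (forall i, (exists j, i = e j) \/ hom0 (Q i) X) ->
  exists A (f : mor A X), addc (fun B => exists i, B = Q i) A /\
    right_approx (addc (fun B => exists i, B = Q i)) f.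
Proof.
move=> addC fin; have [n [Y [A [f [YQ dA fQ]]]]] := right_approx_dsum (Q \o e) X addC.
exists A, f; split.
  by apply: (addc_dsum addC _ dA) => j; have [i ->] := YQ j; exists (e i).
apply: right_approx_addc => B g [i Bi]; subst B; case: (fin i) => [[j ij]|h0].
  by subst i; apply: fQ; exists j.
by exists 0; rewrite compm0; apply: h0.
Qed.

End Autoequivalences.

(** * The opposite category *)

Section Opposite.
Variables (k : fieldType) (C : linCat k).

(** Passing to the opposite category turns right approximations into left ones,
    while direct sums and summands are unchanged. *)
Definition opCat : linCat k :=
  @LinCat k C (fun X Y => mor Y X) (fun X => idm X) (fun X Y Z g f => f \oc g)
    (fun X Y Z W h g f => esym (mcompA f g h))
    (fun X Y f => mcompm1 f) (fun X Y f => mcomp1m f)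
    (fun X Y Z g => mcomp_linl g) (fun X Y Z f => mcomp_linr f).

Lemma dsum_op (I : finType) (Y : I -> C) (Z : C) :
  @is_dsum k opCat I Y Z <-> is_dsum Y Z.
Proof.
split=> -[inj [proj [e1 e0 s1]]]; exists proj, inj; split=> // i j ij;
  by apply: e0; rewrite eq_sym.
Qed.

Lemma additive_op : additive_cat C -> additive_cat opCat.
Proof. by move=> h n X; have [Z dZ] := h n X; exists Z; apply/dsum_op. Qed.

Lemma summand_op (X Y : C) : @is_summand k opCat X Y <-> is_summand X Y.
Proof. by split=> -[X' h]; exists X'; apply/dsum_op. Qed.

Lemma addc_op (Q : C -> Prop) (X : C) : @addc k opCat Q X <-> addc Q X.
Proof.
split=> -[n [Y [Z [QY dZ sX]]]]; exists n, Y, Z.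
  by split=> //; [apply/dsum_op | apply/summand_op].
by split=> //; [apply/dsum_op | apply/summand_op].
Qed.

End Opposite.

Lemma functorially_finite_family (k : fieldType) (C : linCat k)
    (I : Type) (Q : I -> C) : additive_cat C ->
  (forall X, exists (J : finType) (e : J -> I),
     forall i, (exists j, i = e j) \/ hom0 (Q i) X) ->
  (forall X, exists (J : finType) (e : J -> I),
     forall i, (exists j, i = e j) \/ hom0 X (Q i)) ->
  functorially_finite (addc (fun B => exists i, B = Q i)).
Proof.
move=> addC fl fr; split=> X.
  have [J [e fin]] := fl X; have [A [f [UA h]]] := right_approx_exists addC fin.
  by exists A, f.
have [J [e fin]] := fr X.
have [A [f [UA h]]] := @right_approx_exists _ (opCat C) _ Q _ _ X (additive_op addC) fin.
exists A, f; split; first exact/addc_op.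
by move=> B g UB; apply: h; apply/addc_op.
Qed.

(** * Triangles *)

Section Triangles.
Variables (k : fieldType) (T : triCat k).
Implicit Types (X Y Z W : T).

Lemma zero_obj_exists : exists Z : T, is_zero_obj Z.
Proof.
pose none (i : 'I_0) : T := False_rect _ (notF (ltn_ord i)).
have [Z [inj [proj [_ _ s0]]]] := tri_additive none.
by exists Z; rewrite /is_zero_obj -s0 big_ord0.
Qed.

Lemma dist_comp0 X Y Z (f : mor X Y) (g : mor Y Z) h : dist f g h -> g \oc f = 0.
Proof.
move=> fgh; have [O O0] := zero_obj_exists.
have sq : f \oc idm X = f \oc idm X by [].
have [c [<- _]] := dist_mor (dist_id X O0) fgh sq.
by rewrite compm0.
Qed.

(** Exactness of Hom(W, -), obtained by comparing the rotated triangle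
    W -> 0 -> W[1] with Y -> Z -> X[1]; the third map provides y[1]. *)
Lemma dist_exact W X Y Z (f : mor X Y) (g : mor Y Z) h (x : mor W Y) :
  dist f g h -> g \oc x = 0 -> exists y, x = f \oc y.
Proof.
move=> /dist_rot fgh gx; have [O O0] := zero_obj_exists.
have /dist_rot D := dist_id W O0.
have sq : (0 : mor O Z) \oc (0 : mor W O) = g \oc x by rewrite compm0 gx.
have [c [_]] := dist_mor D fgh sq; have [y <-] := autoeq_full c.
rewrite fmap_id compmN mcompm1 compNm => /oppr_inj; rewrite -fmap_comp => e.
by exists y; apply: (@autoeq_faithful _ _ (susp T)).
Qed.

Lemma dist_hom0 W X Y Z (f : mor X Y) (g : mor Y Z) h :
  dist f g h -> hom0 W X -> hom0 W Z -> hom0 W Y.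
Proof.
move=> fgh hX hZ x; have [y ->] := dist_exact fgh (hZ (g \oc x)).
by rewrite (hX y) compm0.
Qed.

(** In a triangulated category every split monomorphism s has a complement,
    namely its cone Z: the connecting map vanishes, so the projection to Z has a
    section t. *)
Lemma retract_summand X A : retract X A -> is_summand X A.
Proof.
move=> [r [s rs]]; have [Z [g [h sgh]]] := dist_cone s.
have ghs := proj1 (dist_rot _ _ _) sgh; have hsg := proj1 (dist_rot _ _ _) ghs.
have gs0 := dist_comp0 sgh.
have h0 : h = 0.
  rewrite -(mcomp1m h) -fmap_id -rs fmap_comp -mcompA.
  have /eqP := dist_comp0 hsg; rewrite compNm oppr_eq0 => /eqP ->.
  by rewrite compm0.
have [t gt] : exists t, idm Z = g \oc t by apply: (dist_exact ghs); rewrite h0 comp0m.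
(* correcting the section so that it is killed by the retraction r *)
pose t' := t - s \oc r \oc t.
have gt' : g \oc t' = idm Z.
  by rewrite compmD compmN !mcompA gs0 !comp0m subr0.
have rt' : r \oc t' = 0.
  by rewrite compmD compmN !mcompA rs mcomp1m subrr.
have e0 : idm A - s \oc r - t' \oc g = 0.
  have [|y e] := @dist_exact A _ _ _ _ _ _ (idm A - s \oc r - t' \oc g) sgh.
    by rewrite !compmD !compmN !mcompA gs0 comp0m gt' mcompm1 mcomp1m subr0 subrr.
  have : r \oc (s \oc y) = 0.
    by rewrite -e !compmD !compmN !mcompA rs rt' comp0m mcompm1 mcomp1m subr0 subrr.
  by rewrite e mcompA rs mcomp1m => ->; rewrite compm0.
exists Z.
exists (fun b => if b return mor (if b then X else Z) A then s else t'),
       (fun b => if b return mor A (if b then X else Z) then r else g).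
split=> [[]|[] []|] //.
by rewrite big_bool /=; move/eqP: e0; rewrite -addrA -opprD subr_eq0 => /eqP.
Qed.

(** Only the converse needs triangles: a sum of composites that is the identity
    of X makes X a retract of the direct sum of the middle objects. *)
Lemma addcP (Q : fullsub T) X : addc Q X <-> factors Q (idm X).
Proof.
split; first exact: addc_factors.
move=> [s e].
pose Y (i : 'I_(size s)) : T := mid (tnth (in_tuple s) i).
have [Z dZ] := tri_additive Y; exists (size s), Y, Z; split=> //.
  by move=> i; apply: midP.
apply: retract_summand; have [inj [proj [e1 e0 _]]] := dZ.
exists (\sum_i (leg2 (tnth (in_tuple s) i) \oc proj i)).
exists (\sum_i (inj i \oc leg1 (tnth (in_tuple s) i))).
rewrite e comp_suml [RHS]big_tnth; apply: eq_bigr => i _.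
rewrite comp_sumr (bigD1 i) //= big1 ?addr0 => [|j ji].
  by rewrite !mcompA -(mcompA (leg2 _)) e1 mcompm1.
by rewrite !mcompA -(mcompA (leg2 _)) e0 // compm0 comp0m.
Qed.

End Triangles.

(** * Serre duality *)

Section Serre.
Variables (k : fieldType) (T : triCat k) (nu : serreFunctor T) (d : nat).
Implicit Types (X Y Z W A B : T).

(** A finite-dimensional space vanishes iff its dual does. *)
Lemma hom0_serre X Y : hom0 X Y <-> hom0 Y (nu X).
Proof.
have [s' ss' s's] := serre_bij nu X Y; split=> h u.
  rewrite -(s's u); suff -> : s' u = 0 by rewrite raddf0.
  by apply/lfunP => f; rewrite (h f) !raddf0.
have phi0 (phi : 'Hom(mor X Y, k^o)) : phi = 0.
  by rewrite -(ss' phi) -(ss' 0) !(h (serre_iso _ _ _ _)).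
rewrite (coord_vbasis (memvf u)) big1 // => i _.
have := lfunE (coord (vbasis fullv) i : {linear mor X Y -> k^o}) u.
by rewrite (phi0 (linfun _)) lfunE /= => e; rewrite -[coord _ _ _]e scale0r.
Qed.

Lemma hom0_shift_adj (i : int) X Y : hom0 (tshift X i) Y <-> hom0 X (tshift Y (- i)).
Proof. exact: hom0_pow_adj. Qed.

(** A substitute for isomorphism, sufficient for the vanishing of Hom spaces and
    easier to obtain: the compatibility of nu with shifts follows from Serre
    duality without constructing a natural transformation. *)
Definition hom_equiv X Y := forall W, hom0 W X <-> hom0 W Y.

Lemma isom_hom_equiv X Y : isom X Y -> hom_equiv X Y.
Proof. by move=> XY W; apply: isom_hom0r. Qed.

Lemma hom_equiv_sym X Y : hom_equiv X Y -> hom_equiv Y X.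
Proof. by move=> h W; split=> /h. Qed.

Lemma hom_equiv_trans Y X Z : hom_equiv X Y -> hom_equiv Y Z -> hom_equiv X Z.
Proof. by move=> h h' W; split=> [/h/h'|/h'/h]. Qed.

Lemma hom_equiv_autoeq (E : autoeq T) X Y : hom_equiv X Y -> hom_equiv (E X) (E Y).
Proof.
move=> h W.
have key Z : hom0 W (E Z) <-> hom0 (ainv E W) Z.
  rewrite -(hom0_fmap E (ainv E W)).
  by apply: isom_hom0l; apply/isom_sym/autoeq_counit_iso.
by split=> /key/h/key.
Qed.

(** Serre duality exchanges the two arguments, so the relation controls maps out
    of the objects as well. *)
Lemma hom_equiv_l X Y W : hom_equiv X Y -> hom0 X W <-> hom0 Y W.
Proof.
by move=> /(hom_equiv_autoeq nu) h; rewrite (hom0_serre X) (hom0_serre Y); apply: h.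
Qed.

Lemma tshiftD X (i j : int) : hom_equiv (tshift (tshift X i) j) (tshift X (i + j)).
Proof. by apply: isom_hom_equiv; rewrite addrC; apply/isom_sym/autoeq_powD. Qed.

Lemma serre_shift X (i : int) : hom_equiv (nu (tshift X i)) (tshift (nu X) i).
Proof.
move=> W; rewrite -(hom0_serre (tshift X i)) hom0_shift_adj (hom0_serre X).
by rewrite hom0_shift_adj opprK.
Qed.

Local Notation N := (nud nu d).

Definition twist (j i : int) X : T := tshift (autoeq_pow N j X) i.

Lemma commutes_inv (E S : autoeq T) :
  (forall X, hom_equiv (E (S X)) (S (E X))) ->
  forall X, hom_equiv (ainv E (S X)) (S (ainv E X)).
Proof.
move=> ES X.
apply: (@hom_equiv_trans (ainv E (S (E (ainv E X))))).
  apply: (hom_equiv_autoeq (autoeq_inv E)); apply: hom_equiv_autoeq.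
  exact/isom_hom_equiv/isom_sym/autoeq_counit_iso.
apply: (@hom_equiv_trans (ainv E (E (S (ainv E X))))).
  by apply: (hom_equiv_autoeq (autoeq_inv E)); apply/hom_equiv_sym/ES.
exact/isom_hom_equiv/autoeq_unit_iso.
Qed.

Lemma commutes_pow (E S : autoeq T) :
  (forall X, hom_equiv (E (S X)) (S (E X))) ->
  forall j X, hom_equiv (autoeq_pow E j (S X)) (S (autoeq_pow E j X)).
Proof.
move=> ES j X; elim: j => [|n IH|n IH]; first by move=> W.
  apply: (@hom_equiv_trans (E (S (autoeq_pow E n X)))); last exact: ES.
  exact: (hom_equiv_autoeq E IH).
have powP Y : hom_equiv (autoeq_pow E (- n.+1%:Z) Y) (ainv E (autoeq_pow E (- n%:Z) Y)).
  have -> : - n.+1%:Z = - n%:Z - 1 by lia.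
  exact/isom_hom_equiv/autoeq_powP.
apply: hom_equiv_trans (powP _) _.
apply: (@hom_equiv_trans (ainv E (S (autoeq_pow E (- n%:Z) X)))).
  exact: (hom_equiv_autoeq (autoeq_inv E) IH).
apply: hom_equiv_trans (commutes_inv ES _) _.
exact/(hom_equiv_autoeq S)/hom_equiv_sym/powP.
Qed.

Lemma nud_shift j i X :
  hom_equiv (autoeq_pow N j (tshift X i)) (tshift (autoeq_pow N j X) i).
Proof.
apply: (@commutes_pow N (autoeq_pow (susp T) i)) => {}X /=.
apply: (@hom_equiv_trans (nu (tshift (tshift X (- d%:Z)) i))).
  apply: hom_equiv_autoeq; apply: hom_equiv_trans (tshiftD _ _ _) _.
  by rewrite addrC; apply/hom_equiv_sym/tshiftD.
exact: serre_shift.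
Qed.

Lemma twist_comp a b a' b' X :
  hom_equiv (twist a b (twist a' b' X)) (twist (a + a') (b + b') X).
Proof.
apply: (@hom_equiv_trans (tshift (tshift (autoeq_pow N a (autoeq_pow N a' X)) b') b)).
  exact/(hom_equiv_autoeq (autoeq_pow (susp T) b))/nud_shift.
apply: hom_equiv_trans (tshiftD _ _ _) _; rewrite (addrC b').
apply: (hom_equiv_autoeq (autoeq_pow (susp T) (b + b'))).
exact/isom_hom_equiv/isom_sym/autoeq_powD.
Qed.

Lemma hom0_twist a b a' b' X Y :
  hom0 (twist a b X) (twist a' b' Y) <-> hom0 X (twist (a' - a) (b' - b) Y).
Proof.
have key : hom0 (twist a b X) (twist a' b' Y) <->
    hom0 X (twist (- a) (- b) (twist a' b' Y)).
  rewrite /twist hom0_shift_adj hom0_pow_adj.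
  exact: nud_shift.
by rewrite key (addrC a') (addrC b'); apply: twist_comp.
Qed.

Lemma hom0_twist0 a b X Y : hom0 (twist a b X) Y <-> hom0 X (twist (- a) (- b) Y).
Proof. by rewrite -[Y]/(twist 0 0 Y) hom0_twist !sub0r. Qed.

(** nu = nu_d o [d], which turns Serre duality into a rule about twists. *)
Lemma serre_nud X : hom_equiv (nu X) (twist 1 d X).
Proof.
apply: (@hom_equiv_trans (nu (tshift (tshift X (- d%:Z)) d%:Z))).
  apply: hom_equiv_autoeq; apply: hom_equiv_sym; apply: hom_equiv_trans (tshiftD _ _ _) _.
  by rewrite addNr; move=> W.
exact: serre_shift.
Qed.

Lemma hom0_twist_serre a b X Y :
  hom0 X (twist a b Y) <-> hom0 Y (twist (1 - a) (d%:Z - b) X).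
Proof. by rewrite -hom0_twist hom0_serre; apply: serre_nud. Qed.

End Serre.

(** * Long exact sequences *)

Section LongExact.
Variables (k : fieldType) (T : triCat k) (nu : serreFunctor T) (d : nat).
Implicit Types (X Y Z W A B : T).
Local Notation twist := (twist nu d).

(** Changes of exponents left to linear arithmetic. *)
Lemma hom0_twist_eq a b a' b' X Y :
  hom0 X (twist a b Y) -> a = a' -> b = b' -> hom0 X (twist a' b' Y).
Proof. by move=> h <- <-. Qed.

Variables (X Y Z : T) (f : mor X Y) (g : mor Y Z) (h : mor Z (susp T X)).
Hypothesis fgh : dist f g h.

Lemma dist_hom0_mid W i :
  hom0 W (twist 0 i X) -> hom0 W (twist 0 i Z) -> hom0 W (twist 0 i Y).
Proof.
by rewrite -[i]opprK -oppr0 -!hom0_twist0; apply: dist_hom0 fgh.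
Qed.

Lemma dist_hom0_cone W i :
  hom0 W (twist 0 i Y) -> hom0 W (twist 0 (i + 1) X) -> hom0 W (twist 0 i Z).
Proof.
move=> hY hX; have ghf := proj1 (dist_rot _ _ _) fgh.
rewrite -[i]opprK -oppr0 -hom0_twist0; apply: (dist_hom0 ghf).
  by rewrite hom0_twist0 oppr0 opprK.
by rewrite -[susp T X]/(twist 0 1 X) hom0_twist; apply: (hom0_twist_eq hX); lia.
Qed.

Lemma dist_hom0_fiber W i :
  hom0 W (twist 0 i Y) -> hom0 W (twist 0 (i - 1) Z) -> hom0 W (twist 0 i X).
Proof.
move=> hY hZ; have ghf := proj1 (dist_rot _ _ _) fgh.
have hfg := proj1 (dist_rot _ _ _) ghf.
suff : hom0 (twist 0 (1 - i) W) (twist 0 1 X).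
  by rewrite hom0_twist => H; apply: (hom0_twist_eq H); lia.
apply: (dist_hom0 hfg).
  by rewrite hom0_twist0; apply: (hom0_twist_eq hZ); lia.
by rewrite -[susp T Y]/(twist 0 1 Y) hom0_twist; apply: (hom0_twist_eq hY); lia.
Qed.

End LongExact.

(** * The orbit of a d-silting object *)

Section Silting.
Variables (k : fieldType) (T : triCat k) (nu : serreFunctor T) (d : nat).
Implicit Types (X Y Z W A B : T).
Local Notation twist := (twist nu d).

Variable P : T.
Hypothesis P_dsilt : d_silting_obj nu d P.
Hypothesis P_adj : admits_adjacent (add_obj P).

(** The aisle T^{<=0} of the t-structure adjacent to P. *)
Let Le0 X := forall i : int, 0 < i -> hom0 P (twist 0 i X).

Lemma add_obj_self : add_obj P P.
Proof. by apply/addcP; rewrite -[idm P]mcomp1m; apply: factors_mid. Qed.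

Lemma add_obj_hom0l X W : add_obj P X -> hom0 P W -> hom0 X W.
Proof. by move=> /addcP PX h; apply: (factors_hom0l PX) => B ->. Qed.

Lemma P_rigid : Le0 P.
Proof.
have [[h _] _] := P_dsilt => i i0.
by apply: h; [exact: add_obj_self | exact: add_obj_self | lia].
Qed.

(** This is what d-silting says beyond silting: nu_d^-1 P lies in the aisle. *)
Lemma P_nud_inv i : 0 < i -> hom0 P (twist (-1) i P).
Proof.
move=> i0; have [_ h] := P_dsilt.
have {}h := h P P (d%:Z + i) add_obj_self add_obj_self ltac:(lia).
rewrite (hom_equiv_l nu _ (serre_nud nu d P)) in h.
rewrite -[tshift P _]/(twist 0 (d%:Z + i) P) hom0_twist in h.
by apply: (hom0_twist_eq h); lia.
Qed.

(** The left orthogonal of all shifts of A is thick, so it is T once it contains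
    P.  Its closure under cones is obtained on the dual side, where exactness of
    Hom(W, -) applies. *)
Lemma generating A : (forall i, hom0 P (twist 0 i A)) -> forall X, hom0 X A.
Proof.
move=> hA X.
have dual i Y : hom0 Y (twist 0 i A) <-> hom0 (twist (-1) (- (d%:Z - i)) A) Y.
  by rewrite hom0_twist_serre hom0_twist0; split=> h; apply: (hom0_twist_eq h); lia.
have [[_ Pthick] _] := P_dsilt.
suff U_thick : is_thick (fun X => forall i, hom0 X (twist 0 i A)).
  by apply: (Pthick X _ U_thick _ 0) => Y PY i; apply: (add_obj_hom0l PY).
split=> [Z Z0 i f|Y j hY i|X1 X2 Z f g h fgh h1 h2 i|Y Z /summand_retract YZ hZ i].
- by rewrite -(mcompm1 f) Z0 compm0.
- rewrite -[tshift Y j]/(twist 0 j Y) hom0_twist.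
  by apply: (hom0_twist_eq (hY (i - j))); lia.
- apply/dual; apply: (dist_hom0 (proj1 (dist_rot _ _ _) fgh)); first exact/dual.
  rewrite -[susp T X1]/(twist 0 1 X1) hom0_twist; have /dual := h1 (i - 1).
  by rewrite hom0_twist0 => H; apply: (hom0_twist_eq H); lia.
- exact: retract_hom0l YZ (hZ i).
Qed.

Lemma truncation Z : exists A B (f : mor A Z) (g : mor Z B) (h : mor B (susp T A)),
  [/\ dist f g h, Le0 A & forall A', Le0 A' -> hom0 A' B].
Proof.
have [L [G [[_ _ _ LG tr] LP]]] := P_adj.
have Le0P X : Le0 X <-> L X.
  rewrite LP; split=> [h Q i PQ i0|h i i0]; first exact: (add_obj_hom0l PQ (h i i0)).
  exact: h _ _ add_obj_self i0.
have [A [B [f [g [h [LA GB fgh]]]]]] := tr Z.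
exists A, B, f, g, h; split=> // [|A' /Le0P LA']; first exact/Le0P.
exact: LG.
Qed.

Lemma Le0_shift A i : 0 <= i -> Le0 A -> Le0 (twist 0 i A).
Proof.
move=> i0 LA j j0; apply/twist_comp.
by have H := LA (j + i) ltac:(lia); apply: (hom0_twist_eq H); lia.
Qed.

(** The Le0-part A' of Y satisfies Hom(P, A'[i]) = 0 for every i: for i > 0 by
    definition of the aisle, and for i <= 0 by exactness, since Hom(P, Y[i]) = 0
    and the other part B is right orthogonal to P[1-i].  Hence A' is zero. *)
Lemma Le0_orth A Y : Le0 A -> (forall i, i <= 0 -> hom0 P (twist 0 i Y)) -> hom0 A Y.
Proof.
move=> LA hY; have [A' [B [f [g [h [fgh LA' hB]]]]]] := truncation Y.
apply: (dist_hom0 fgh); last exact: hB.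
apply: generating => i; case: (ltrP 0 i) => i0; first exact: LA'.
apply: (dist_hom0_fiber fgh (hY i i0)).
have := hB _ (Le0_shift (_ : 0 <= 1 - i) P_rigid); rewrite hom0_twist0 => H.
by apply: (hom0_twist_eq (H _)); lia.
Qed.

(** By Serre duality, nu_d^-1 A in the aisle means Hom(A, nu_d^2 P[d-i]) = 0 for
    i > 0, which can be tested on the shifts of P. *)
Lemma Le0_nud_inv A : Le0 A -> Le0 (twist (-1) 0 A).
Proof.
move=> LA i i0.
suff : hom0 A (twist 2 (d%:Z - i) P).
  rewrite hom0_twist_serre => H; apply/twist_comp.
  by apply: (hom0_twist_eq H); lia.
apply: Le0_orth LA _ => l l0; apply/twist_comp.
rewrite hom0_twist_serre; have H := P_nud_inv (_ : 0 < i - l).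
by apply: (hom0_twist_eq (H _)); lia.
Qed.

Lemma P_orbit_Le0 n i : 0 < i -> hom0 P (twist (- n%:Z) i P).
Proof.
move=> i0; suff : Le0 (twist (- n%:Z) 0 P).
  by move=> /(_ _ i0) /twist_comp H; apply: (hom0_twist_eq H); lia.
elim: n => [|n IH]; first exact: P_rigid.
move=> j j0; have /twist_comp/twist_comp H := Le0_nud_inv IH j0.
by apply/twist_comp; apply: (hom0_twist_eq H); lia.
Qed.

(** Serre duality exchanges j with 1 - j and i with d - i, so that one of the two
    sides always concerns a nonpositive power of nu_d. *)
Lemma orbit_rigid (j i : int) : 0 < i < d%:Z -> hom0 P (twist j i P).
Proof.
move=> /andP[i0 id]; case: j => [[|n]|n].
- exact: P_rigid.
- rewrite hom0_twist_serre; have H := @P_orbit_Le0 n (d%:Z - i).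
  by apply: (hom0_twist_eq (H _)); lia.
- by have H := @P_orbit_Le0 n.+1 i i0; apply: (hom0_twist_eq H); lia.
Qed.

Definition orbit_orth X := forall j i : int, 0 < i < d%:Z -> hom0 P (twist j i X).

Lemma orbit_orth_twist j X : orbit_orth X -> orbit_orth (twist j 0 X).
Proof.
by move=> h l i hi; apply/twist_comp; apply: (hom0_twist_eq (h (l + j) i hi)); lia.
Qed.

(** Both ends of the truncation triangle A -> Y -> B are retracts of Y once the
    connecting map B -> A[1] is zero.  That map vanishes by Serre duality, as B
    sits in degrees >= d and the aisle is stable under nu_d^-1. *)
Lemma local_dichotomy Y : local_end Y -> orbit_orth Y ->
  Le0 Y \/ forall i, i < d%:Z -> hom0 P (twist 0 i Y).
Proof.
move=> [Y0 YL] hY; have [A [B [f [g [h [fgh LA hB]]]]]] := truncation Y.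
have geB i : i < d%:Z -> hom0 P (twist 0 i B).
  move=> id; case: (ltrP 0 i) => i0.
    by apply: (dist_hom0_cone fgh); [apply: hY; lia | apply: LA; lia].
  have := hB _ (Le0_shift (_ : 0 <= - i) P_rigid); rewrite hom0_twist0 => H.
  by apply: (hom0_twist_eq (H _)); lia.
have h0 : h = 0.
  suff : hom0 B (twist 0 1 A) by apply.
  rewrite hom0_twist_serre.
  suff : hom0 (twist (-1) 0 A) (twist 0 (d%:Z - 1) B).
    by rewrite hom0_twist0 => /twist_comp H; apply: (hom0_twist_eq H); lia.
  apply: Le0_orth (Le0_nud_inv LA) _ => l l0; apply/twist_comp.
  have H := geB (d%:Z - 1 + l) ltac:(lia).
  by apply: (hom0_twist_eq H); lia.
have [s gs] : exists s, idm B = g \oc s.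
  by apply: (dist_exact (proj1 (dist_rot _ _ _) fgh)); rewrite h0 comp0m.
have retr i : hom0 P (twist 0 i B) -> retract Y B -> hom0 P (twist 0 i Y).
  move=> hi YB; rewrite -[i]opprK -oppr0 -hom0_twist0; apply: (retract_hom0r YB).
  by rewrite hom0_twist0 oppr0 opprK.
(* s \oc g is the idempotent of Y with image B; Y being local, it or its
   complement is invertible *)
have [e_iso|e_niso] := classic (is_iso (s \oc g)).
  right=> i /geB hi; apply: (retr _ hi).
  have [t [te et]] := e_iso.
  by exists (t \oc s), g; rewrite -mcompA.
have [e'_iso|e'_niso] := classic (is_iso (idm Y - s \oc g)); last first.
  case: (YL _ _ e_niso e'_niso); rewrite addrC subrK.
  by exists (idm Y); rewrite mcomp1m.
left; have [t [te et]] := e'_iso.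
have g0 : g = 0.
  rewrite -(mcompm1 g) -et mcompA compmD compmN mcompm1 mcompA -gs mcomp1m.
  by rewrite subrr comp0m.
have B0 W : hom0 W B by apply: idm_eq0_hom0; rewrite gs g0 comp0m.
move=> i i0; apply: (dist_hom0_mid fgh); first exact: LA.
by rewrite -[i]opprK -oppr0 -hom0_twist0; apply: B0.
Qed.

Hypothesis T_fin : nud_finite nu d.

Lemma from_orbit_finite X :
  exists n : int, forall j i, j <= n -> 0 <= i -> hom0 P (twist j i X).
Proof.
have [n h] := T_fin P X; exists (- n) => j i jn i0.
by have H := h (- j) i ltac:(lia) i0; apply: (hom0_twist_eq H); lia.
Qed.

Lemma to_orbit_finite X :
  exists n : int, forall j i, n <= j -> i <= d%:Z -> hom0 P (twist j i X).
Proof.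
have [n h] := T_fin X P; exists (n + 1) => j i jn id.
rewrite hom0_twist_serre.
by have H := h (j - 1) (d%:Z - i) ltac:(lia) ltac:(lia); apply: (hom0_twist_eq H); lia.
Qed.

(** An object of the aisle that also has Hom(P, X[i]) = 0 for all i <= 0 is zero,
    so X leaves the aisle under large powers of nu_d. *)
Lemma last_Le0 X : local_end X ->
  exists j, Le0 (twist j 0 X) /\ ~ Le0 (twist (j + 1) 0 X).
Proof.
move=> [X0 _]; have [n hn] := from_orbit_finite X; have [m hm] := to_orbit_finite X.
have Ln : Le0 (twist n 0 X).
  move=> i i0; apply/twist_comp.
  by have H := hn n i ltac:(lia) ltac:(lia); apply: (hom0_twist_eq H); lia.
have nLm l : m <= l -> ~ Le0 (twist l 0 X).
  move=> ml LX; apply: X0.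
  suff : hom0 (twist l 0 X) (twist l 0 X) by rewrite hom0_twist subrr; apply.
  apply: generating => i; case: (ltrP 0 i) => i0; first exact: LX.
  by apply/twist_comp; have H := hm l i ml ltac:(lia); apply: (hom0_twist_eq H); lia.
apply: NNPP => nex.
have all_L (l : nat) : Le0 (twist (n + l%:Z) 0 X).
  elim: l => [|l IH]; first by rewrite addr0.
  apply: NNPP => nL; apply: nex; exists (n + l%:Z); split=> //.
  by rewrite -addrA -PoszD addn1.
by apply: (nLm (n + `|m - n|%N%:Z)); [lia | apply: all_L].
Qed.

(** By duality the second hypothesis says Hom(Y, P[i]) = 0 for i > 0.  With f a
    right add P-approximation of Y and Z its cone, Z[-1] lies in the aisle, so
    Hom(Y, Z) = 0 and the identity of Y lifts along f. *)
Lemma Le0_perp_factors Y : Le0 Y ->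
  (forall i, i < d%:Z -> hom0 P (twist 1 i Y)) -> factors (fun B => B = P) (idm Y).
Proof.
move=> LY hY.
have [n [Q [P0 [f [QP dP0 fP]]]]] :=
  right_approx_dsum (fun _ : 'I_1 => P) Y (@tri_additive k T).
have [Z [g [h fgh]]] := dist_cone f.
have LP0 i : 0 < i -> hom0 P (twist 0 i P0).
  move=> i0; rewrite -[i]opprK -oppr0 -hom0_twist0.
  apply: (dsum_hom0r dP0) => l; have [_ ->] := QP l.
  by rewrite hom0_twist0 oppr0 opprK; apply: P_rigid.
have LZ : Le0 (twist 0 (-1) Z).
  move=> i i0; apply/twist_comp.
  suff : hom0 P (twist 0 (i - 1) Z) by [].
  have [i1|i1] := ltrP 1 i; last first.
    have -> : i - 1 = 0 by lia.
    move=> x; have ghf := proj1 (dist_rot _ _ _) fgh.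
    have [y ->] : exists y, x = g \oc y.
      by apply: (dist_exact ghf); apply: (LP0 1).
    have [z ->] : exists z, y = f \oc z by apply: fP; exists ord0.
    by rewrite mcompA (dist_comp0 fgh) comp0m.
  apply: (dist_hom0_cone fgh); first by apply: LY; lia.
  by apply: LP0; lia.
have g0 : g = 0.
  suff : hom0 Y (twist 0 0 Z) by apply.
  rewrite hom0_twist_serre.
  suff : hom0 (twist 0 (-1) Z) (twist 1 (d%:Z - 1) Y).
    by rewrite hom0_twist0 => /twist_comp H; apply: (hom0_twist_eq H); lia.
  apply: Le0_orth LZ _ => l l0; apply/twist_comp.
  by have H := hY (d%:Z - 1 + l) ltac:(lia); apply: (hom0_twist_eq H); lia.
have [s es] : exists s, idm Y = f \oc s.
  by apply: (dist_exact fgh); rewrite g0 comp0m.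
have YP0 : retract Y P0 by exists f, s.
apply: (factors_retract YP0); apply: (factors_dsum dP0) => l.
by have [_ ->] := QP l; rewrite -[idm P]mcomp1m; apply: factors_mid.
Qed.

Let orbit B := exists j, B = autoeq_pow (nud nu d) j P.

(** At the last j with nu_d^j X in the aisle, the dichotomy applied to
    nu_d^(j+1) X leaves only the alternative of degrees >= d. *)
Lemma local_orbit X : local_end X -> orbit_orth X -> factors orbit (idm X).
Proof.
move=> XL hX; have [j [Lj nLj]] := last_Le0 XL.
have L1 : forall i, i < d%:Z -> hom0 P (twist 0 i (twist (j + 1) 0 X)).
  have [] // := local_dichotomy (_ : local_end (twist (j + 1) 0 X)) (orbit_orth_twist hX).
  exact: (local_end_autoeq (autoeq_pow (nud nu d) (j + 1)) XL).
have F : factors (fun B => B = P) (idm (twist j 0 X)).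
  apply: Le0_perp_factors Lj _ => i /L1 /twist_comp H; apply/twist_comp.
  by apply: (hom0_twist_eq H); lia.
pose E := autoeq_pow (nud nu d) (- j).
apply: (@factors_retract _ _ _ _ (E (twist j 0 X))).
  exact/isom_retract/isom_sym/autoeq_powNK.
rewrite -fmap_id; apply: factors_fmap F => B ->; by exists (- j).
Qed.

Hypothesis KS : krull_schmidt T.

(** The Krull-Schmidt decomposition reduces the converse to indecomposable X.  Both
    orthogonality conditions of cluster tilting, and the dependence of U_d(P) on
    add P alone, are read off from this description. *)
Lemma Ud_orbit_orth X : Ud nu d P X <-> orbit_orth X.
Proof.
rewrite /Ud addcP; split=> [FX j i hi|hX].
  rewrite -[i]opprK -[j]opprK -hom0_twist0; apply: (factors_hom0r FX) => _ [l ->].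
  rewrite -[autoeq_pow _ _ _]/(twist l 0 P) hom0_twist.
  by have H := @orbit_rigid (l + j) i hi; apply: (hom0_twist_eq H); lia.
have [n [Y [YL dX]]] := KS X; apply: (factors_dsum dX) => l.
apply: local_orbit => // j i hi; rewrite -[i]opprK -[j]opprK -hom0_twist0.
by apply: (retract_hom0r (dsum_retract l dX)); rewrite hom0_twist0 !opprK; apply: hX.
Qed.

Lemma Ud_functorially_finite : functorially_finite (Ud nu d P).
Proof.
have window (n m : int) : exists (J : finType) (e : J -> int),
    forall i, n < i < m -> exists j, i = e j.
  exists 'I_(`|m - n|%N), (fun j : 'I_(`|m - n|%N) => n + (j : nat)%:Z) => i hi.
  have lt : (`|i - n| < `|m - n|)%N by lia.
  by exists (Ordinal lt) => /=; lia.
apply: (@functorially_finite_family k T int (fun j => autoeq_pow (nud nu d) j P)).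
- exact: tri_additive.
- move=> X; have [n hn] := from_orbit_finite X; have [m hm] := to_orbit_finite X.
  have [J [e he]] := window (- m) (- n); exists J, e => i.
  have [/he|hi] := boolP (- m < i < - n); [by left | right].
  rewrite -[autoeq_pow _ _ _]/(twist i 0 P) hom0_twist0 oppr0.
  have [|] := lerP i (- m) => im; [apply: hm | apply: hn]; lia.
- move=> X; have [n hn] := from_orbit_finite X; have [m hm] := to_orbit_finite X.
  (* Serre duality exchanges i with 1 - i *)
  have [J [e he]] := window (1 - m) (1 - n); exists J, e => i.
  have [/he|hi] := boolP (1 - m < i < 1 - n); [by left | right].
  rewrite -[autoeq_pow _ _ _]/(twist i 0 P) hom0_twist_serre subr0.
  have [|] := lerP i (1 - m) => im; [apply: hm | apply: hn]; lia.
Qed.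

(** The substitution of 1 - j for j and d - i for i exchanges the left and the
    right orthogonality condition. *)
Lemma Ud_cluster_tilting : cluster_tilting d (Ud nu d P).
Proof.
have U_orbit j : Ud nu d P (autoeq_pow (nud nu d) j P).
  apply/addcP; rewrite -[idm _]mcomp1m; apply: factors_mid; by exists j.
split; first exact: Ud_functorially_finite.
- move=> X; rewrite Ud_orbit_orth; split=> [hX Y i /addcP FY hi|h j i hi].
    apply: (factors_hom0l FY) => _ [j ->].
    rewrite -[autoeq_pow _ _ _]/(twist j 0 P) -[tshift _ _]/(twist 0 i X) hom0_twist.
    by have H := hX (- j) i ltac:(lia); apply: (hom0_twist_eq H); lia.
  have := h _ i (U_orbit (- j)) ltac:(lia).
  rewrite -[autoeq_pow _ _ _]/(twist (- j) 0 P) -[tshift _ _]/(twist 0 i X).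
  rewrite hom0_twist => H.
  by apply: (hom0_twist_eq H); lia.
- move=> X; rewrite Ud_orbit_orth; split=> [hX Y i /addcP FY hi|h j i hi].
    rewrite -[tshift _ _]/(twist 0 i Y) -[i]opprK -oppr0 -hom0_twist0.
    apply: (factors_hom0r FY) => _ [j ->].
    rewrite -[autoeq_pow _ _ _]/(twist j 0 P) hom0_twist hom0_twist_serre.
    by have H := hX (1 - j) (d%:Z - i) ltac:(lia); apply: (hom0_twist_eq H); lia.
  have := h _ (d%:Z - i) (U_orbit (1 - j)) ltac:(lia).
  rewrite -[tshift _ _]/(twist 0 (d%:Z - i) (twist (1 - j) 0 P)) => /twist_comp.
  by rewrite hom0_twist_serre => H; apply: (hom0_twist_eq H); lia.
Qed.

End Silting.

Lemma orbit_orth_add (k : fieldType) (T : triCat k) (nu : serreFunctor T) d (P Q X : T) :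
  add_obj Q P -> orbit_orth nu d Q X -> orbit_orth nu d P X.
Proof. by move=> QP h j i hi; apply: (add_obj_hom0l QP); apply: h. Qed.

Theorem theorem1p2 (k : fieldType) (d : nat) (T : triCat k) (nu : serreFunctor T) :
  (1 <= d)%N ->
  krull_schmidt T ->
  nud_finite nu d ->
  (exists P : T, silting_obj P) ->
  admits_adjacent_tstructures T ->
  (forall P : T, d_silting_obj nu d P -> cluster_tilting d (Ud nu d P)) /\
  (forall P Q : T, d_silting_obj nu d P -> d_silting_obj nu d Q ->
     (forall X : T, add_obj P X <-> add_obj Q X) ->
     forall X : T, Ud nu d P X <-> Ud nu d Q X).
Proof.
move=> _ KS fin _ adj.
have adjP P : d_silting_obj nu d P -> admits_adjacent (add_obj P).
  by move=> [sP _]; apply: adj.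
split=> [P dP|P Q dP dQ PQ X]; first exact: Ud_cluster_tilting (adjP _ dP) _ _.
rewrite !Ud_orbit_orth //; try exact: adjP.
by split; apply: orbit_orth_add; apply/PQ/add_obj_self.
Qed.
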